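(* Let $(G,c,\boldsymbol{b})$ be an instance of the robust transshipment problem under consistent flow constraints on a pearl digraph $G=(V,A=A^{\mathrm{fix}}\cup A^{\mathrm{free}})$ (in the normalized form described in the context) that admits a robust $\boldsymbol{b}$-flow. Then the state-of-balance algorithm described in the context computes an optimal robust $\boldsymbol{b}$-flow in $\mathcal{O}(|V|\cdot|\Lambda|)$ time.
   Context: An instance $(G,c,\boldsymbol{b})$ of the robust transshipment problem under consistent flow constraints consists of: a (multi-)digraph $G=(V,A)$ whose arc set is partitioned into two disjoint sets, $A=A^{\mathrm{fix}}\cup A^{\mathrm{free}}$ (fixed and free arcs); an arc cost $c:A\to\mathbb{Z}_{\ge 0}$; a finite set of scenarios $\Lambda$; and for each $\lambda\in\Lambda$ vertex balances $b^\lambda:V\to\mathbb{Z}$ with $\sum_{v\in V}b^\lambda(v)=0$; write $\boldsymbol{b}=(b^1,\ldots,b^{|\Lambda|})$. There are no arc capacities and no restriction on the number or location of sources (positive balance) and sinks (negative balance). For $\lambda\in\Lambda$, a $b^\lambda$-flow is a function $f^\lambda:A\to\mathbb{Z}_{\ge 0}$ with $\sum_{a=(v,w)\in A}f^\lambda(a)-\sum_{a=(w,v)\in A}f^\lambda(a)=b^\lambda(v)$ for every $v\in V$; its cost is $c(f^\lambda)=\sum_{a\in A}c(a)f^\lambda(a)$. A robust $\boldsymbol{b}$-flow is a tuple $\boldsymbol{f}=(f^1,\ldots,f^{|\Lambda|})$ of $b^\lambda$-flows such that $f^\lambda(a)=f^{\lambda'}(a)$ for all $a\in A^{\mathrm{fix}}$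 and all $\lambda,\lambda'\in\Lambda$; its cost is $c(\boldsymbol{f})=\max_{\lambda\in\Lambda}c(f^\lambda)$. It is optimal if it has minimum cost among all robust $\boldsymbol{b}$-flows. A pearl digraph is a path consisting of multi-arcs (equivalently, a series-parallel digraph whose series-parallel decomposition tree has no parallel-composition vertex with a series-composition child). Normalized form: $V=\{v_1,\ldots,v_n\}$, and for each $i\in\{1,\ldots,n-1\}$ the arcs from $v_i$ to $v_{i+1}$ consist of at most one fixed arc $a_i^{\mathrm{fix}}=(v_i,v_{i+1})\in A^{\mathrm{fix}}$ and at most one free arc $a_i^{\mathrm{free}}=(v_i,v_{i+1})\in A^{\mathrm{free}}$, at least one of them existing; there are no other arcs; and $c(a_i^{\mathrm{fix}})<c(a_i^{\mathrm{free}})$ whenever both exist. The state at $v_i$ in scenario $\lambda$ is $\sigma^\lambda_{v_i}=\sum_{j=1}^i b^\lambda(v_j)$, and $\sigma^{\min}_{v_i}=\min_{\lambda\in\Lambda}\sigma^\lambda_{v_i}$. The algorithm: compute all $\sigma^\lambda_{v_i}$ and all $\sigma^{\min}_{v_i}$; for every $\lambda\in\Lambda$ and $i\in\{1,\ldots,n-1\}$ set: if both $a_i^{\mathrm{fix}}$ and $a_i^{\mathrm{free}}$ exist, $f^\lambda(a_i^{\mathrm{fix}})=\sigma^{\min}_{v_i}$ and $f^\lambda(a_i^{\mathrm{free}})=\sigma^\lambda_{v_i}-\sigma^{\min}_{v_i}$; if only one of the two arcs exists, the flow on it is $\sigma^\lambda_{v_i}$. Return $\boldsymbol{f}=(f^1,\ldots,f^{|\Lambda|})$.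 *)

(* Defs.v *)
From mathcomp Require Import all_boot all_order all_algebra.
Set Implicit Arguments.
Unset Strict Implicit.
Unset Printing Implicit Defensive.
Import Order.TTheory GRing.Theory Num.Theory.
Local Open Scope ring_scope.

(* Free arcs are the complement of [fixed].  Scenarios are nonempty: otherwise
   the maximum in the cost and the minimum in [state_min] have no meaning. *)
Record instance := Instance {
  vertT : finType;
  arcT : finType;
  src : arcT -> vertT;
  tgt : arcT -> vertT;
  fixed : {set arcT};
  cost : arcT -> nat;
  scenT : finType;
  scen_gt0 : (0 < #|scenT|)%N;
  bal : scenT -> vertT -> int;
  bal_sum0 : forall l, \sum_(v : vertT) bal l v = 0
}.
Arguments src {i} a.
Arguments tgt {i} a.
Arguments fixed {i}.
Arguments cost {i} a.
Arguments bal {i} l v.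

Section Flows.
Variable I : instance.
Implicit Types (f : scenT I -> arcT I -> nat) (g : arcT I -> nat).

Definition is_flow (b : vertT I -> int) g : Prop :=
  forall v, (\sum_(a | src a == v) g a)%N%:Z - (\sum_(a | tgt a == v) g a)%N%:Z
            = b v.

Definition flow_cost g : nat := (\sum_(a : arcT I) cost a * g a)%N.

Definition robust_flow f : Prop :=
  (forall l, is_flow (bal l) (f l)) /\
  (forall a, a \in fixed -> forall l l', f l a = f l' a).

Definition robust_cost f : nat := \max_(l : scenT I) flow_cost (f l).

Definition optimal_robust_flow f : Prop :=
  robust_flow f /\ forall f', robust_flow f' -> (robust_cost f <= robust_cost f')%N.

End Flows.

(* A presentation of the digraph as a normalized pearl digraph.  Indices start
   at 0: there are [pearl_len.+1] vertices, and position [i : 'I_pearl_len] is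
   the multi-arc between consecutive vertices [pv i] and [pv (i + 1)].
   [None] means that the fixed (free) arc at that position does not exist. *)
Record pearl (I : instance) := Pearl {
  pearl_len : nat;
  pv : 'I_pearl_len.+1 -> vertT I;
  afix : 'I_pearl_len -> option (arcT I);
  afree : 'I_pearl_len -> option (arcT I);
  pv_bij : bijective pv;
  afixP : forall i a, afix i = Some a <->
    [/\ a \in fixed, src a = pv (widen_ord (leqnSn _) i)
      & tgt a = pv (lift ord0 i)];
  afreeP : forall i a, afree i = Some a <->
    [/\ a \notin fixed, src a = pv (widen_ord (leqnSn _) i)
      & tgt a = pv (lift ord0 i)];
  arc_exists : forall i, afix i \/ afree i;
  arc_path : forall a, exists i,
    src a = pv (widen_ord (leqnSn _) i) /\ tgt a = pv (lift ord0 i);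
  cost_lt : forall i a a', afix i = Some a -> afree i = Some a' ->
    (cost a < cost a')%N
}.

Arguments pv {I} p i.
Arguments afix {I} p i.
Arguments afree {I} p i.

Section StateOfBalance.
Variables (I : instance) (P : pearl I).

Definition state (l : scenT I) (i : 'I_(pearl_len P).+1) : int :=
  \sum_(j < (pearl_len P).+1 | (j <= i)%N) bal l (pv P j).

(* The scenario that initializes the iterated minimum is immaterial. *)
Definition state_min (i : 'I_(pearl_len P).+1) : int :=
  \big[Num.min/state (enum_val (Ordinal (scen_gt0 I))) i]_(l : scenT I) state l i.

(* Every arc occurs in [afix] or [afree], so this determines [f]. *)
Definition state_of_balance (f : scenT I -> arcT I -> int) : Prop :=
  forall l (i : 'I_(pearl_len P)),
    let vi := widen_ord (leqnSn _) i in
    match afix P i, afree P i with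
    | Some a, Some a' => f l a = state_min vi /\
                         f l a' = state l vi - state_min vi
    | Some a, None | None, Some a => f l a = state l vi
    | None, None => True
    end.

End StateOfBalance.

(* Running time is measured on a random-access machine with unbounded integers,
   integer registers and two-dimensional integer arrays.  Arithmetic,
   comparisons, register and array accesses, constants, assignments and
   loop steps cost 1 each. *)
Inductive expr :=
  | Const of int
  | Reg of nat
  | Get of nat & expr & expr
  | Add of expr & expr
  | Sub of expr & expr.

Inductive cmd :=
  | Skip
  | Assign of nat & expr
  | Put of nat & expr & expr & expr
  | Seq of cmd & cmd
  | IfLe of expr & expr & cmd & cmd
  | For of nat & expr & cmd.

Record store := Store {
  reg : nat -> int;
  arr : nat -> int -> int -> int;
  clock : nat
}.

Fixpoint eval (s : store) (e : expr) : int :=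
  match e with
  | Const z => z
  | Reg x => reg s x
  | Get a e1 e2 => arr s a (eval s e1) (eval s e2)
  | Add e1 e2 => eval s e1 + eval s e2
  | Sub e1 e2 => eval s e1 - eval s e2
  end.

Fixpoint ecost (e : expr) : nat :=
  match e with
  | Const _ | Reg _ => 1
  | Get _ e1 e2 | Add e1 e2 | Sub e1 e2 => (ecost e1 + ecost e2).+1
  end.

Definition tick (k : nat) (s : store) : store :=
  Store (reg s) (arr s) (clock s + k).

Definition set_reg (x : nat) (z : int) (s : store) : store :=
  Store (fun y => if y == x then z else reg s y) (arr s) (clock s).

Definition set_arr (a : nat) (p q z : int) (s : store) : store :=
  Store (reg s)
    (fun a' p' q' => if [&& a' == a, p' == p & q' == q] then z else arr s a' p' q')
    (clock s).

(* [For x e c] evaluates the bound [e] once and runs [c] with [x] set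
   successively to 0, 1, ..., e - 1 (not at all if [e] is negative). *)
Fixpoint exec (c : cmd) (s : store) : store :=
  match c with
  | Skip => tick 1 s
  | Assign x e => tick (ecost e).+1 (set_reg x (eval s e) s)
  | Put a e1 e2 e =>
      tick (ecost e1 + ecost e2 + ecost e).+1
        (set_arr a (eval s e1) (eval s e2) (eval s e) s)
  | Seq c1 c2 => exec c2 (exec c1 s)
  | IfLe e1 e2 c1 c2 =>
      let s' := tick (ecost e1 + ecost e2).+1 s in
      if eval s e1 <= eval s e2 then exec c1 s' else exec c2 s'
  | For x e c1 =>
      foldl (fun (t : store) (k : nat) => exec c1 (tick 1 (set_reg x k%:Z t)))
        (tick (ecost e).+1 s)
        (iota 0 (if eval s e is Posz m then m else 0%N))
  end.

Notation rN := 0%N (only parsing). (* input: number of vertices *)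
Notation rK := 1%N (only parsing). (* input: number of scenarios *)
Notation rI := 2%N (only parsing).
Notation rL := 3%N (only parsing).
Notation rS := 4%N (only parsing).
Notation aBal := 0%N (only parsing).   (* input: balance, by scenario, position *)
Notation aFix := 1%N (only parsing).   (* input: fixed arc at (position, 0) *)
Notation aFree := 2%N (only parsing).  (* input: free arc at (position, 0) *)
Notation aState := 3%N (only parsing). (* state, by scenario, position *)
Notation aMin := 4%N (only parsing).   (* minimum state at (position, 0) *)
Notation aFlow := 5%N (only parsing).  (* output: flow, by scenario, arc *)

Definition compute_states : cmd :=
  For rL (Reg rK)
    (Seq (Assign rS (Const 0))
    (For rI (Reg rN)
      (Seq (Assign rS (Add (Reg rS) (Get aBal (Reg rL) (Reg rI))))
           (Put aState (Reg rL) (Reg rI) (Reg rS))))).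

Definition compute_minima : cmd :=
  For rI (Reg rN)
    (Seq (Assign rS (Get aState (Const 0) (Reg rI)))
    (Seq (For rL (Reg rK)
           (IfLe (Get aState (Reg rL) (Reg rI)) (Reg rS)
             (Assign rS (Get aState (Reg rL) (Reg rI)))
             Skip))
         (Put aMin (Reg rI) (Const 0) (Reg rS)))).

Definition compute_flow : cmd :=
  let sig := Get aState (Reg rL) (Reg rI) in
  let smin := Get aMin (Reg rI) (Const 0) in
  let fix_arc := Get aFix (Reg rI) (Const 0) in
  let free_arc := Get aFree (Reg rI) (Const 0) in
  For rL (Reg rK)
    (For rI (Sub (Reg rN) (Const 1))
      (IfLe (Const 0) fix_arc
        (IfLe (Const 0) free_arc
          (Seq (Put aFlow (Reg rL) fix_arc smin)
               (Put aFlow (Reg rL) free_arc (Sub sig smin)))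
          (Put aFlow (Reg rL) fix_arc sig))
        (Put aFlow (Reg rL) free_arc sig))).

Definition state_of_balance_algorithm : cmd :=
  Seq compute_states (Seq compute_minima compute_flow).

Definition rank (T : finType) (x : T) : int := (enum_rank x : nat)%:Z.

(* A missing arc is encoded by -1. *)
Definition arc_code (T : finType) (o : option T) : int :=
  if o is Some a then rank a else -1.

(* Nothing is assumed about the rest of the store. *)
Definition encodes (I : instance) (P : pearl I) (s : store) : Prop :=
  [/\ reg s rN = #|vertT I|%:Z,
      reg s rK = #|scenT I|%:Z,
      forall l (i : 'I_(pearl_len P).+1), arr s aBal (rank l) i%:Z = bal l (pv P i),
      forall i : 'I_(pearl_len P), arr s aFix i%:Z 0 = arc_code (afix P i)
    & forall i : 'I_(pearl_len P), arr s aFree i%:Z 0 = arc_code (afree P i)].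

Definition output (I : instance) (s : store) (l : scenT I) (a : arcT I) : int :=
  arr s aFlow (rank l) (rank a).

Lemma encodes_exists (I : instance) (P : pearl I) : exists s, encodes P s.
Proof.
pose ord T n (d : T) (F : 'I_n -> T) (z : int) : T :=
  if z is Posz k then if insub k is Some i then F i else d else d.
have ordE T n (d : T) (F : 'I_n -> T) (i : 'I_n) : ord T n d F i%:Z = F i.
  by rewrite /ord /= valK.
clearbody ord.
exists (Store (fun x => if x == rN then #|vertT I|%:Z else #|scenT I|%:Z)
  (fun a p q =>
     if a == aBal then
       ord _ _ 0 (fun k : 'I_#|scenT I| => ord _ _ 0 (fun i => bal (enum_val k) (pv P i)) q) p
     else if a == aFix then ord _ _ 0 (fun i => arc_code (afix P i)) p
     else ord _ _ 0 (fun i => arc_code (afree P i)) p) 0).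
by split=> //= [l i|i|i]; rewrite ?/rank !ordE ?enum_rankK.
Qed.

(* Main.v *)
Require Import Defs.
From mathcomp Require Import all_boot all_order all_algebra.
From mathcomp Require Import zify.
Import Order.TTheory GRing.Theory Num.Theory.
Local Open Scope ring_scope.
Set Implicit Arguments.
Unset Strict Implicit.

(** A flow on a pearl digraph is a flow along a path: the arcs that
    leave the set of vertices up to [i] are those at position [i], and no arc
    enters this set, so the total flow at position [i] must equal the state there, and conversely these totals suffice for
    conservation at every vertex ([flow_stateP]).  Hence the only freedom of a
    robust flow is how much of the state it puts on the fixed arc of a position
    that also has a free arc.  This amount is the same in all scenarios and is at
    most the flow total in each of them, so it is at most the minimum state
    ([fixed_flow_le_state_min]).  Since the fixed arc is the cheaper one, sending
    exactly the minimum state through it is cheapest at every position and in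
    every scenario simultaneously ([state_of_balance_cost]), and therefore also
    for the maximum over the scenarios.  The existence of some robust flow is
    used twice: it makes all states nonnegative, and it makes the states
    independent of the scenario at positions with a fixed arc only, which is what
    consistency of the computed flow needs there.

    The program is verified by loop invariants.  A command changes only the
    registers and arrays that it mentions as targets ([exec_frame]); the rule
    [exec_For] supplies this fact in the middle of a loop, so that an invariant
    need only describe the data that the loop produces.  The same rule yields the
    running time: a loop whose body takes bounded time is linear in its number of
    iterations ([clock_For]), and the three phases are pairs of nested loops over
    scenarios and positions. *)

(** * Frame property and loop rules for the random-access machine *)

Fixpoint assigned (c : cmd) : seq nat :=
  match c with
  | Skip | Put _ _ _ _ => [::]
  | Assign x _ => [:: x]
  | Seq c1 c2 | IfLe _ _ c1 c2 => assigned c1 ++ assigned c2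
  | For x _ c1 => x :: assigned c1
  end.

Fixpoint stored (c : cmd) : seq nat :=
  match c with
  | Skip | Assign _ _ => [::]
  | Put a _ _ _ => [:: a]
  | Seq c1 c2 | IfLe _ _ c1 c2 => stored c1 ++ stored c2
  | For _ _ c1 => stored c1
  end.

Definition agree_off (xs ys : seq nat) (s t : store) : Prop :=
  (forall x, x \notin xs -> reg t x = reg s x) /\
  (forall a, a \notin ys -> arr t a =2 arr s a).

Lemma agree_off_refl xs ys s : agree_off xs ys s s.
Proof. by split. Qed.

Lemma agree_off_trans xs ys s t u :
  agree_off xs ys s t -> agree_off xs ys t u -> agree_off xs ys s u.
Proof.
move=> [st1 st2] [tu1 tu2]; split=> [x hx|a ha p q].
  by rewrite tu1 ?st1.
by rewrite tu2 ?st2.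
Qed.

Lemma agree_off_sub xs ys xs' ys' s t :
    {subset xs <= xs'} -> {subset ys <= ys'} ->
  agree_off xs ys s t -> agree_off xs' ys' s t.
Proof.
move=> hx hy [h1 h2]; split=> [x /(contra (hx x))|a /(contra (hy a))].
  exact: h1.
exact: h2.
Qed.

Lemma foldl_iota_ind (T : Type) (J : nat -> T -> Prop) (F : T -> nat -> T) m s :
    J 0%N s ->
    (forall k t, (k < m)%N -> J k t -> J k.+1 (F t k)) ->
  J m (foldl F s (iota 0 m)).
Proof.
move=> J0; elim: m => [|m IHm] JS; first by [].
rewrite -[in iota _ _]addn1 iotaD foldl_cat; apply: (JS) => //.
by apply: IHm => k t km; apply: JS; apply: ltnW.
Qed.

Lemma exec_frame c s : agree_off (assigned c) (stored c) s (exec c s).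
Proof.
elim: c s => [|x e|a e1 e2 e|c1 IH1 c2 IH2|e1 e2 c1 IH1 c2 IH2|x e c IHc] s /=.
- exact: agree_off_refl.
- by split=> //= y; rewrite inE => /negbTE->.
- by split=> //= b; rewrite inE => /negbTE->.
- apply: agree_off_trans (agree_off_sub _ _ (IH1 s))
                         (agree_off_sub _ _ (IH2 _)) => y; rewrite mem_cat => -> //;
  by rewrite orbT.
- case: ifP => _.
    by apply: agree_off_sub (IH1 (tick _ s)) => y; rewrite mem_cat => ->.
  by apply: agree_off_sub (IH2 (tick _ s)) => y; rewrite mem_cat => ->; rewrite orbT.
- apply: (foldl_iota_ind (J := fun _ => agree_off (x :: assigned c) (stored c) s)) => //.
  move=> k t _ st; apply: agree_off_trans st _.
  apply: agree_off_trans (agree_off_sub _ _ (IHc _)) => //.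
    by split=> //= y; rewrite inE negb_or => /andP[/negbTE->].
  by move=> y; rewrite inE => ->; rewrite orbT.
Qed.

(** The invariant [J] is indexed by the number of completed iterations.  That
    everything outside the targets of the loop is as at the start is a free
    consequence of [exec_frame], hence available to the step and absent from
    [J]. *)
Lemma exec_For x e c s m (J : nat -> store -> Prop) :
    eval s e = m%:Z ->
    J 0%N (tick (ecost e).+1 s) ->
    (forall k t, (k < m)%N -> agree_off (x :: assigned c) (stored c) s t ->
       J k t -> J k.+1 (exec c (tick 1 (set_reg x k%:Z t)))) ->
  J m (exec (For x e c) s).
Proof.
move=> em J0 JS; rewrite /= em.
pose A := agree_off (x :: assigned c) (stored c) s.
suff: A (foldl (fun t k => exec c (tick 1 (set_reg x k%:Z t)))
           (tick (ecost e).+1 s) (iota 0 m)) /\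
      J m (foldl (fun t k => exec c (tick 1 (set_reg x k%:Z t)))
           (tick (ecost e).+1 s) (iota 0 m)) by case.
apply: (foldl_iota_ind (J := fun k t => A t /\ J k t)).
  by split=> //; apply: agree_off_refl.
move=> k t km [At Jt]; split; last exact: JS.
apply: agree_off_trans At _.
apply: agree_off_trans (agree_off_sub _ _ (exec_frame _ _)) => //.
  by split=> //= y; rewrite inE negb_or => /andP[/negbTE->].
by move=> y; rewrite inE => ->; rewrite orbT.
Qed.

(** The bound on the body may rely on the registers untouched by the loop, since
    the number of iterations of an inner loop is read from such a register.  The
    extra unit per iteration is the price of a loop step. *)
Lemma clock_For x e c s m B :
    eval s e = m%:Z ->
    (forall k t, agree_off (x :: assigned c) (stored c) s t ->
       (clock (exec c (set_reg x k%:Z t)) <= clock t + B)%N) ->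
  (clock (exec (For x e c) s) <= clock s + ((ecost e).+1 + m * B.+1))%N.
Proof.
move=> em cB.
apply: (exec_For (m := m) (J := fun k t =>
  (clock t <= clock s + ((ecost e).+1 + k * B.+1))%N)) => //=.
  by rewrite mul0n addn0.
move=> k t _ st kt; apply: leq_trans (cB k (tick 1 t) st) _ => /=.
by rewrite mulSn; lia.
Qed.

(** * The phases that compute the states and their minima *)

(** Row [l] of the state array is final once iteration [l] is over, because
    later iterations write to other rows only.  Within a row the accumulator
    register holds the current prefix sum. *)
Lemma compute_statesP s n k :
    reg s rN = n%:Z -> reg s rK = k%:Z ->
  forall l i, (l < k)%N -> (i < n)%N ->
  arr (exec compute_states s) aState l%:Z i%:Z = \sum_(j < i.+1) arr s aBal l%:Z j%:Z.
Proof.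
move=> sn sk l i lk; move: l lk i; rewrite /compute_states.
apply: (exec_For (m := k) (J := fun k t => forall l, (l < k)%N -> forall i, (i < n)%N ->
  arr t aState l%:Z i%:Z = \sum_(j < i.+1) arr s aBal l%:Z j%:Z)) => //.
move=> k' t _ [tr ta] Jt.
(* The body as an inner loop started after the reset of the accumulator. *)
set body := For _ _ _.
change (exec _ (tick 1 _)) with
  (exec body (tick 2 (set_reg rS 0 (tick 1 (set_reg rL k'%:Z t))))).
set t0 := tick 2 _.
have [In other]: (forall i, (i < n)%N -> arr (exec body t0) aState k'%:Z i%:Z =
    \sum_(j < i.+1) arr s aBal k'%:Z j%:Z) /\
    (forall p q, p != k'%:Z -> arr (exec body t0) aState p q = arr t aState p q).
  suff [_ ? ?] : [/\ reg (exec body t0) rS = \sum_(j < n) arr s aBal k'%:Z j%:Z,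
     forall i, (i < n)%N -> arr (exec body t0) aState k'%:Z i%:Z =
       \sum_(j < i.+1) arr s aBal k'%:Z j%:Z &
     forall p q, p != k'%:Z -> arr (exec body t0) aState p q = arr t aState p q] by [].
  apply: (exec_For (m := n) (J := fun n t' =>
    [/\ reg t' rS = \sum_(j < n) arr s aBal k'%:Z j%:Z,
     forall i, (i < n)%N -> arr t' aState k'%:Z i%:Z =
       \sum_(j < i.+1) arr s aBal k'%:Z j%:Z &
     forall p q, p != k'%:Z -> arr t' aState p q = arr t aState p q])).
  - by rewrite /= tr.
  - by split=> //=; rewrite big_ord0.
  - move=> i u _ [ur ua] [u4 u3 uo]; split.
    + by rewrite /= u4 ua // ur //= ta // big_ord_recr.
    + move=> i'; rewrite ltnS leq_eqVlt => /predU1P[->|lti] /=.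
        by rewrite ur //= !eqxx /= u4 ua // ta // big_ord_recr.
      rewrite ur //= eqxx /= eqz_nat ltn_eqF //= u3 //.
    + by move=> p q pk; rewrite /= ur //= (negbTE pk) uo.
move=> l; rewrite ltnS leq_eqVlt => /predU1P[->|ltl] i lti; first exact: In.
by rewrite other ?Jt // eqz_nat ltn_eqF.
Qed.

(** The inner body costs at most 12, to which the loop step adds 1; the remaining
    constants pay for the reset of the accumulator and for the loop bounds.  The
    constants of the other two phases arise in the same way. *)
Lemma clock_compute_states s n k :
    reg s rN = n%:Z -> reg s rK = k%:Z ->
  (clock (exec compute_states s) <= clock s + (2 + k * (n * 13 + 5)))%N.
Proof.
move=> sn sk; apply: leq_trans (@clock_For _ _ _ _ k (n * 13 + 4) _ _) _ => //.
  move=> l t [tr _].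
  set t0 := exec (Assign rS (Const 0)) (set_reg rL l%:Z t).
  change (exec (Seq _ _) _) with (exec (For rI (Reg rN)
    (Seq (Assign rS (Add (Reg rS) (Get aBal (Reg rL) (Reg rI))))
         (Put aState (Reg rL) (Reg rI) (Reg rS)))) t0).
  apply: leq_trans (@clock_For _ _ _ t0 n 12 _ _) _ => [|i u _|] /=.
  - by rewrite tr.
  - by lia.
  - by lia.
by rewrite /=; lia.
Qed.

(** The loop and [state_min] fold the states in different orders; being an
    attained lower bound determines the value and is easy to maintain in either
    of them. *)
Lemma compute_minimaP s n k :
    reg s rN = n%:Z -> reg s rK = k%:Z -> (0 < k)%N ->
  forall i, (i < n)%N ->
  (forall l, (l < k)%N -> arr (exec compute_minima s) aMin i%:Z 0 <= arr s aState l%:Z i%:Z) /\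
  (exists2 l, (l < k)%N & arr (exec compute_minima s) aMin i%:Z 0 = arr s aState l%:Z i%:Z).
Proof.
move=> sn sk k_gt0.
apply: (exec_For (m := n) (J := fun n t => forall i, (i < n)%N ->
  (forall l, (l < k)%N -> arr t aMin i%:Z 0 <= arr s aState l%:Z i%:Z) /\
  (exists2 l, (l < k)%N & arr t aMin i%:Z 0 = arr s aState l%:Z i%:Z))) => //.
move=> i t _ [tr ta] Jt.
(* The body as an inner loop between the initialization and the final store. *)
set body := For _ _ _.
set t0 := (exec (Assign rS (Get aState (Const 0) (Reg rI))) (tick 1 (set_reg rI i%:Z t))).
change (exec _ (tick 1 _)) with (exec (Put aMin (Reg rI) (Const 0) (Reg rS)) (exec body t0)).
have [bodyr bodya] := exec_frame body t0.
have [le_min ex_min]: (forall l, (l < k)%N -> reg (exec body t0) rS <= arr s aState l%:Z i%:Z) /\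
    (exists2 l, (l < k)%N & reg (exec body t0) rS = arr s aState l%:Z i%:Z).
  apply: (exec_For (m := k) (J := fun k' t =>
    (forall l, (l < k')%N -> reg t rS <= arr s aState l%:Z i%:Z) /\
    (exists2 l, (l < k)%N & reg t rS = arr s aState l%:Z i%:Z))).
  - by rewrite /= tr.
  (* The accumulator starts with the state of scenario 0, which exists by [k_gt0]. *)
  - by split=> //=; exists 0%N; rewrite //= ta.
  - move=> l u ltl [ur ua] [le_u ex_u] /=; rewrite ua //= ur //= ta //.
    case: ifP => le_l /=; last first.
      split=> // l'; rewrite ltnS leq_eqVlt => /predU1P[->|/le_u] //.
      by rewrite ltW // ltNge le_l.
    split; last by exists l.
    move=> l'; rewrite ltnS leq_eqVlt => /predU1P[->|/le_u] //.
    exact: le_trans.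
move=> i'; rewrite ltnS /= bodyr //= => le_i.
have [->|ne_i] := eqVneq i' i; first by rewrite !eqxx.
rewrite eqz_nat (negbTE ne_i) /= bodya //; apply: Jt.
by rewrite ltn_neqAle ne_i.
Qed.

Lemma clock_compute_minima s n k :
    reg s rN = n%:Z -> reg s rK = k%:Z ->
  (clock (exec compute_minima s) <= clock s + (2 + n * (k * 10 + 11)))%N.
Proof.
move=> sn sk; apply: leq_trans (@clock_For _ _ _ _ n (k * 10 + 10) _ _) _ => //.
  move=> i t [tr _].
  set t0 := (exec (Assign rS (Get aState (Const 0) (Reg rI))) (set_reg rI i%:Z t)).
  have : (clock (exec (For rL (Reg rK) (IfLe (Get aState (Reg rL) (Reg rI)) (Reg rS)
             (Assign rS (Get aState (Reg rL) (Reg rI))) Skip)) t0)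
          <= clock t0 + (2 + k * 10))%N.
    apply: (@clock_For _ _ _ _ k 9) => //=; first by rewrite tr.
    by move=> l u _; case: ifP => _ /=; lia.
  have t0c : clock t0 = (clock t + 4)%N by [].
  rewrite t0c -(leq_add2r 4) => /leq_trans; apply.
  by lia.
by rewrite /=; lia.
Qed.

Lemma clock_compute_flow s n k :
    reg s rN = n.+1%:Z -> reg s rK = k%:Z ->
  (clock (exec compute_flow s) <= clock s + (2 + k * (n * 31 + 5)))%N.
Proof.
move=> sn sk; apply: leq_trans (@clock_For _ _ _ _ k (n * 31 + 4) _ _) _ => //.
  move=> l t [tr _].
  apply: leq_trans (@clock_For _ _ _ _ n 30 _ _) _ => //=.
  - by rewrite tr // sn -addn1 PoszD addrK.
  - by move=> i u _; do 2?case: ifP => _ /=; lia.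
  - by lia.
by rewrite /=; lia.
Qed.

(** * Flows on a pearl digraph *)

Section PearlFlows.
Variables (I : instance) (P : pearl I).
Implicit Types (l : scenT I) (i : 'I_(pearl_len P)) (a : arcT I).

Notation tail i := (widen_ord (leqnSn (pearl_len P)) i).
Notation head i := (lift ord0 i).

Lemma pv_inj : injective (pv P).
Proof. exact: bij_inj (pv_bij P). Qed.

Lemma tail_inj : injective (fun i => tail i).
Proof. by move=> i j /(congr1 val) /= /val_inj. Qed.

Lemma card_vert : #|vertT I| = (pearl_len P).+1.
Proof. by rewrite -(bij_eq_card (pv_bij P)) card_ord. Qed.

(** Positions determine both endpoints of an arc, so the arcs that enter a
    vertex are those that leave its predecessor: inflow becomes outflow one
    position earlier. *)
Lemma tgt_head a i : (tgt a == pv P (head i)) = (src a == pv P (tail i)).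
Proof.
have [j [-> ->]] := arc_path P a.
by rewrite !(inj_eq pv_inj) (inj_eq lift_inj) (inj_eq tail_inj).
Qed.

Lemma tgt_first a : (tgt a == pv P ord0) = false.
Proof.
by have [j [_ ->]] := arc_path P a; rewrite (inj_eq pv_inj) eq_sym (negbTE (neq_lift _ _)).
Qed.

Lemma src_last a : (src a == pv P ord_max) = false.
Proof.
have [j [-> _]] := arc_path P a; rewrite (inj_eq pv_inj) -val_eqE /=.
by rewrite ltn_eqF.
Qed.

Lemma afixE i a : a \in fixed -> src a = pv P (tail i) -> afix P i = Some a.
Proof. by move=> fa sa; apply/afixP; split=> //; apply/eqP; rewrite tgt_head sa. Qed.

Lemma afreeE i a : a \notin fixed -> src a = pv P (tail i) -> afree P i = Some a.
Proof. by move=> fa sa; apply/afreeP; split=> //; apply/eqP; rewrite tgt_head sa. Qed.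

Lemma sum_arcs_at i (F : arcT I -> nat) :
  (\sum_(a | src a == pv P (tail i)) F a =
   oapp F 0 (afix P i) + oapp F 0 (afree P i))%N.
Proof.
rewrite (bigID (fun a => a \in fixed)) /=; congr (_ + _)%N.
  case E: (afix P i) => [a0|] /=.
    have [f0 s0 _] := (afixP _ _).1 E.
    rewrite (big_pred1 a0) // => a; apply/andP/eqP => [[/eqP sa fa]|->].
      by have := afixE fa sa; rewrite E => -[].
    by rewrite s0 f0.
  by rewrite big_pred0 // => a; apply/andP => -[/eqP sa fa]; rewrite (afixE fa sa) in E.
case E: (afree P i) => [a0|] /=.
  have [f0 s0 _] := (afreeP _ _).1 E.
  rewrite (big_pred1 a0) // => a; apply/andP/eqP => [[/eqP sa fa]|->].
    by have := afreeE fa sa; rewrite E => -[].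
  by rewrite s0 f0.
by rewrite big_pred0 // => a; apply/andP => -[/eqP sa fa]; rewrite (afreeE fa sa) in E.
Qed.

Lemma state_first l : state l (@ord0 (pearl_len P)) = bal l (pv P ord0).
Proof.
by rewrite /state (big_pred1 ord0) // => j; rewrite /= leqn0.
Qed.

Lemma state_succ l i : state l (head i) = state l (tail i) + bal l (pv P (head i)).
Proof.
rewrite /state (bigD1 (head i)) //= addrC; congr (_ + _).
apply: eq_bigl => j; rewrite -val_eqE /= /bump /= add1n andbC.
by rewrite -ltn_neqAle.
Qed.

Lemma state_last l : state l (@ord_max (pearl_len P)) = 0.
Proof.
rewrite -[RHS](bal_sum0 l) (reindex (pv P)) /=; last exact/onW_bij/pv_bij.
by apply: eq_bigl => j; rewrite -ltnS ltn_ord.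
Qed.

(** Conservation at a vertex says that the flow total at its position minus the
    total at the preceding one is its balance, which is the recursion satisfied by
    the states; at the last vertex, which no arc leaves, it holds because the
    balances sum to 0. *)
Lemma flow_stateP l (g : arcT I -> nat) :
  is_flow (bal l) g <->
  forall i, (oapp g 0 (afix P i) + oapp g 0 (afree P i))%N%:Z = state l (tail i).
Proof.
split=> [flow i|out_state v].
  (* Induction along the path; the total at the previous position is the inflow. *)
  rewrite -sum_arcs_at; have [m] := ubnP (val i).
  elim: m i => // m IHm i; rewrite ltnS => le_im.
  have := flow (pv P (tail i)).
  case: (unliftP ord0 (tail i)) => [j jE|->]; last first.
    by rewrite (eq_bigl _ _ tgt_first) big_pred0_eq subr0 state_first.
  rewrite jE (eq_bigl _ _ (fun a => tgt_head a j)) state_succ IHm.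
    by move/(canRL (subrK _)) ->; rewrite addrC.
  by apply: leq_trans le_im; rewrite -[val i]/(val (tail i)) jE.
(* The last vertex has no outgoing position and is treated separately. *)
have out j : (\sum_(a | src a == pv P j) g a)%N%:Z = state l j.
  have [ltj|] := ltnP j (pearl_len P).
    have -> : j = tail (Ordinal ltj) by apply: val_inj.
    by rewrite sum_arcs_at out_state.
  rewrite leq_eqVlt ltnNge -ltnS ltn_ord orbF => /eqP jE.
  have -> : j = ord_max by apply: val_inj.
  by rewrite state_last (eq_bigl _ _ src_last) big_pred0_eq.
have [pv' _ pvK] := pv_bij P; rewrite -[v]pvK; move: (pv' v) => j.
rewrite out; case: (unliftP ord0 j) => [i|] ->.
  by rewrite (eq_bigl _ _ (fun a => tgt_head a i)) out state_succ addrC addKr.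
by rewrite (eq_bigl _ _ tgt_first) big_pred0_eq subr0 state_first.
Qed.

Lemma flow_cost_split (g : arcT I -> nat) :
  (flow_cost g = \sum_i (oapp (fun a => cost a * g a) 0 (afix P i) +
                         oapp (fun a => cost a * g a) 0 (afree P i)))%N.
Proof.
rewrite /flow_cost (partition_big (@src I) xpredT) //=.
rewrite (reindex (pv P)) /=; last exact/onW_bij/pv_bij.
rewrite big_ord_recr /= [X in (_ + X)%N]big_pred0 ?addn0; last exact: src_last.
by apply: eq_bigr => i _; rewrite -sum_arcs_at.
Qed.

Lemma state_min_le l (j : 'I_(pearl_len P).+1) : state_min j <= state l j.
Proof. exact: bigmin_le. Qed.

Lemma state_min_attained (j : 'I_(pearl_len P).+1) :
  exists l, state_min j = state l j.
Proof.
rewrite /state_min; elim/big_ind: _ => [|x y [l ->] [l' ->]|l _].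
- by eexists.
- by case: leP; [exists l | exists l'].
- by exists l.
Qed.

(** * Optimality of the state-of-balance flow *)

Section Optimality.
Variable f0 : scenT I -> arcT I -> nat.
Hypothesis f0_robust : robust_flow f0.

Let out_state l i :
  (oapp (f0 l) 0 (afix P i) + oapp (f0 l) 0 (afree P i))%N%:Z = state l (tail i).
Proof. exact: (flow_stateP l (f0 l)).1 (f0_robust.1 l) i. Qed.

Lemma state_ge0 l i : 0 <= state l (tail i).
Proof. by rewrite -out_state. Qed.

Lemma state_min_ge0 i : 0 <= state_min (tail i).
Proof. by have [l ->] := state_min_attained (tail i); apply: state_ge0. Qed.

Lemma state_of_balance_ge0 (g : scenT I -> arcT I -> int) :
  state_of_balance P g -> forall l a, 0 <= g l a.
Proof.
move=> sob l a; have [i [sa _]] := arc_path P a; have := sob l i => /=.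
have [fa|fa] := boolP (a \in fixed).
  rewrite (afixE fa sa); case: (afree P i) => [a'|->]; last exact: state_ge0.
  by case=> -> _; apply: state_min_ge0.
rewrite (afreeE fa sa); case: (afix P i) => [a'|->]; last exact: state_ge0.
by case=> _ ->; rewrite subr_ge0 state_min_le.
Qed.

(** The flow on a fixed arc does not depend on the scenario, so it may be read
    off in the scenario that attains the minimum state. *)
Lemma fixed_flow_le_state_min l i a :
  afix P i = Some a -> (f0 l a)%:Z <= state_min (tail i).
Proof.
move=> E; have [fa _ _] := (afixP _ _).1 E.
have [l' ->] := state_min_attained (tail i).
by rewrite (f0_robust.2 a fa l l') -out_state E lez_nat leq_addr.
Qed.

(** With a free arc present the fixed arc carries the minimum state, which does
    not mention the scenario.  Without one it carries the state, which any robust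
    flow forces to be the same in all scenarios. *)
Lemma state_of_balance_robust (f : scenT I -> arcT I -> nat) :
  state_of_balance P (fun l a => (f l a)%:Z) -> robust_flow f.
Proof.
move=> sob; split=> [l|a fa l l'].
  apply/flow_stateP => i; have /= := sob l i.
  case E: (afix P i) (arc_exists i) => [a|] /=; case: (afree P i) => [a'|] //=.
  - by move=> _ [fa fa']; rewrite PoszD fa fa' addrC subrK.
  - by rewrite addn0.
  - by case.
have [i [sa _]] := arc_path P a; have := (sob l i, sob l' i).
have := (out_state l i, out_state l' i).
rewrite /= (afixE fa sa); case: (afree P i) => [a'|] /=.
  by move=> _ [[fl _] [fl' _]]; apply/eqP; rewrite -eqz_nat fl fl'.
rewrite !addn0 => -[E E'] [fl fl']; apply/eqP; rewrite -eqz_nat fl fl' -E -E'.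
by rewrite (f0_robust.2 a fa l l').
Qed.

(** Position by position, both flows send the same total, and the computed one
    sends at least as much of it through the cheaper fixed arc. *)
Lemma state_of_balance_cost (f : scenT I -> arcT I -> nat) l :
  state_of_balance P (fun l a => (f l a)%:Z) -> (flow_cost (f l) <= flow_cost (f0 l))%N.
Proof.
move=> sob; rewrite !flow_cost_split; apply: leq_sum => i _.
have /= := sob l i; have := out_state l i.
case E: (afix P i) => [a|]; case E': (afree P i) => [a'|] //=.
- move=> out [fa fa'].
  have le_a := fixed_flow_le_state_min l E; have lt_c := cost_lt E E'.
  have sum_eq : (f l a + f l a' = f0 l a + f0 l a')%N by lia.
  have {}le_a : (f0 l a <= f l a)%N by lia.
  by nia.
- by move=> out fa; have -> : f0 l a = f l a by lia.
- by move=> out fa; have -> : f0 l a' = f l a' by lia.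
Qed.

End Optimality.

Lemma state_of_balance_optimal (f0 f : scenT I -> arcT I -> nat) :
    robust_flow f0 -> state_of_balance P (fun l a => (f l a)%:Z) ->
  optimal_robust_flow f.
Proof.
move=> f0_robust sob; split; first exact: (state_of_balance_robust f0_robust sob).
move=> f' f'_robust; apply/bigmax_leqP => l _.
apply: leq_trans (state_of_balance_cost f'_robust l sob) _.
exact: (leq_bigmax (F := fun l => flow_cost (f' l))).
Qed.

(** * The phase that computes the flow *)

(** One instance of [state_of_balance], for a single scenario and position: the
    unit of progress of the loops that compute the flow. *)
Definition balanced_at l i (g : arcT I -> int) : Prop :=
  match afix P i, afree P i with
  | Some a, Some a' => g a = state_min (tail i) /\
                       g a' = state l (tail i) - state_min (tail i)
  | Some a, None | None, Some a => g a = state l (tail i)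
  | None, None => True
  end.

Lemma balanced_at_ext l i (g g' : arcT I -> int) :
    (forall a, src a = pv P (tail i) -> g' a = g a) ->
  balanced_at l i g -> balanced_at l i g'.
Proof.
move=> gg'; rewrite /balanced_at.
case E: (afix P i) => [a|]; case E': (afree P i) => [a'|] //.
- have [_ sa _] := (afixP _ _).1 E; have [_ sa' _] := (afreeP _ _).1 E'.
  by rewrite !gg'.
- by have [_ sa _] := (afixP _ _).1 E; rewrite gg'.
- by have [_ sa' _] := (afreeP _ _).1 E'; rewrite gg'.
Qed.

Lemma rank_eq (T : finType) (x y : T) : (rank x == rank y) = (x == y).
Proof. by rewrite eqz_nat (inj_eq val_inj) (inj_eq enum_rank_inj). Qed.

(** The flow array is indexed by arcs and not by positions, so no iteration may
    overwrite the result of an earlier one: arcs at different positions have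
    different tails, and different scenarios use different rows. *)
Lemma compute_flowP s :
    reg s rN = (pearl_len P).+1%:Z -> reg s rK = #|scenT I|%:Z ->
    (forall i, arr s aFix i%:Z 0 = arc_code (afix P i)) ->
    (forall i, arr s aFree i%:Z 0 = arc_code (afree P i)) ->
    (forall l i, arr s aState (rank l) i%:Z = state l (tail i)) ->
    (forall i, arr s aMin i%:Z 0 = state_min (tail i)) ->
  state_of_balance P (output (exec compute_flow s)).
Proof.
move=> sn sk sfix sfree sst smin.
suff all_l l : (enum_rank l < #|scenT I|)%N ->
    forall i, balanced_at l i (output (exec compute_flow s) l).
  by move=> l i; apply: all_l.
move: l; apply: (exec_For (m := #|scenT I|) (J := fun k t => forall l,
  (enum_rank l < k)%N -> forall i, balanced_at l i (output t l))) => //.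
move=> k t ltk [tr ta] Jt.
have [l0 kE] : exists l0 : scenT I, k%:Z = rank l0.
  by exists (enum_val (Ordinal ltk)); rewrite /rank enum_valK.
set t0 := tick 1 _; set body := For _ _ _.
have [In other] : (forall i, (i < pearl_len P)%N ->
     balanced_at l0 i (output (exec body t0) l0)) /\
   (forall p q, p != rank l0 -> arr (exec body t0) aFlow p q = arr t aFlow p q).
  apply: (exec_For (m := pearl_len P) (J := fun m u =>
    (forall i, (i < m)%N -> balanced_at l0 i (output u l0)) /\
    (forall p q, p != rank l0 -> arr u aFlow p q = arr t aFlow p q))) => //.
    by rewrite /= tr // sn -addn1 PoszD addrK.
  move=> m u ltm [ur ua] [Ju Ou].
  pose i := Ordinal ltm; set u' := exec _ _.
  (* Effect of one iteration: position [i] becomes correct, and only arcs at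
     position [i] in row [l0] change. *)
  have [now old row] : [/\ balanced_at l0 i (output u' l0),
     forall a, src a != pv P (tail i) -> output u' l0 a = output u l0 a &
     forall p q, p != rank l0 -> arr u' aFlow p q = arr u aFlow p q].
    have Efix : arr u aFix m%:Z 0 = arc_code (afix P i) by rewrite ua //= ta // -sfix.
    have Efree : arr u aFree m%:Z 0 = arc_code (afree P i) by rewrite ua //= ta // -sfree.
    have Est : arr u aState (rank l0) m%:Z = state l0 (tail i) by rewrite ua //= ta // -sst.
    have Emin : arr u aMin m%:Z 0 = state_min (tail i) by rewrite ua //= ta // -smin.
    have EL : reg u rL = rank l0 by rewrite ur.
    have other_arc a b : src a = pv P (tail i) -> src b != pv P (tail i) -> (b == a) = false.
      by move=> sa; apply: contraNF => /eqP->; rewrite sa.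
    rewrite /u' /= Efix Efree /balanced_at /output.
    case E: (afix P i) (arc_exists i) => [a|] /=; case E': (afree P i) => [a'|] //=.
    - have [fa sa _] := (afixP _ _).1 E; have [fa' sa' _] := (afreeP _ _).1 E'.
      have ne_a : a != a' by apply: contraNneq fa' => <-.
      move=> _; rewrite EL Est Emin; split=> [|b sb|p q pl].
      + by rewrite !eqxx /= !rank_eq (negbTE ne_a).
      + by rewrite !eqxx /= !rank_eq (other_arc a) ?(other_arc a').
      + by rewrite (negbTE pl).
    - have [fa sa _] := (afixP _ _).1 E.
      move=> _; rewrite EL Est; split=> [|b sb|p q pl].
      + by rewrite !eqxx.
      + by rewrite !eqxx /= !rank_eq other_arc.
      + by rewrite (negbTE pl).
    - have [fa sa _] := (afreeP _ _).1 E'.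
      move=> _; rewrite EL Est; split=> [|b sb|p q pl].
      + by rewrite !eqxx.
      + by rewrite !eqxx /= !rank_eq other_arc.
      + by rewrite (negbTE pl).
    - by case.
  split=> [j|p q pl]; last by rewrite row ?Ou.
  have [->|ne_j] := eqVneq j i; first by [].
  rewrite ltnS => le_j; apply: (balanced_at_ext (g := output u l0)).
    move=> a sa; apply: old; rewrite sa (inj_eq pv_inj) (inj_eq tail_inj).
    exact: ne_j.
  by apply: Ju; rewrite ltn_neqAle le_j andbT; apply: contraNneq ne_j => jE;
     apply/eqP/val_inj.
move=> l le_l i; have [->|ne_l] := eqVneq l l0; first exact: In.
apply: (balanced_at_ext (g := output t l)) => [a _|].
  by apply: other; rewrite rank_eq.
apply: Jt; rewrite ltn_neqAle -ltnS le_l andbT; apply: contraNneq ne_l => lE.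
by rewrite -rank_eq -kE /rank lE.
Qed.

End PearlFlows.

(** * Correctness, optimality and running time of the algorithm *)

Theorem theorem5 :
  exists C : nat,
  forall (I : instance) (P : pearl I) (s : store),
    (exists f : scenT I -> arcT I -> nat, robust_flow f) ->
    encodes P s ->
    let t := exec state_of_balance_algorithm s in
    exists f : scenT I -> arcT I -> nat,
      [/\ forall (l : scenT I) (a : arcT I), output t l a = (f l a)%:Z,
          state_of_balance P (fun (l : scenT I) (a : arcT I) => (f l a)%:Z),
          optimal_robust_flow f
        & (clock t <= clock s + C * (#|vertT I| * #|scenT I|))%N].
Proof.
(* The three phases take at most 2 + k * (13n + 5), 2 + n * (10k + 11) and
   2 + k * (31(n - 1) + 5) steps for n vertices and k scenarios; as n, k >= 1,
   all terms are at most multiples of nk. *)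
exists 83%N => I P s [f0 f0_robust] [sn sk sbal sfix sfree].
set t := exec _ _; rewrite (card_vert P) in sn *.
pose s1 := exec compute_states s; pose s2 := exec compute_minima s1.
have -> : t = exec compute_flow s2 by []; clear t.
have [r1 a1] : agree_off _ _ s s1 := exec_frame compute_states s.
have [r2 a2] : agree_off _ _ s1 s2 := exec_frame compute_minima s1.
have s1n : reg s1 rN = (pearl_len P).+1%:Z by rewrite r1.
have s1k : reg s1 rK = #|scenT I|%:Z by rewrite r1.
have s2n : reg s2 rN = (pearl_len P).+1%:Z by rewrite r2.
have s2k : reg s2 rK = #|scenT I|%:Z by rewrite r2.
have st1 l (j : 'I_(pearl_len P).+1) : arr s1 aState (rank l) j%:Z = state l j.
  rewrite (compute_statesP sn sk (ltn_ord _) (ltn_ord _)).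
  rewrite (big_ord_widen _ (fun i : nat => arr s aBal (rank l) i%:Z) (ltn_ord j)).
  by apply: eq_big => [i|i _]; rewrite ?ltnS ?sbal.
have min2 (j : 'I_(pearl_len P).+1) : arr s2 aMin j%:Z 0 = state_min j.
  have [le_min [l0 ltl0 eq_min]] := compute_minimaP s1n s1k (scen_gt0 I) (ltn_ord j).
  have l0E : l0%:Z = rank (enum_val (Ordinal ltl0)) by rewrite /rank enum_valK.
  apply/le_anti/andP; split.
    by have [l ->] := state_min_attained j; rewrite -st1; apply: le_min.
  by rewrite eq_min l0E st1 state_min_le.
have sob : state_of_balance P (output (exec compute_flow s2)).
  apply: compute_flowP => // [i|i|l i|i].
  - by rewrite a2 // a1 // sfix.
  - by rewrite a2 // a1 // sfree.
  - by rewrite a2 //; apply: (st1 l (widen_ord (leqnSn _) i)).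
  - exact: (min2 (widen_ord (leqnSn _) i)).
have out_ge0 := state_of_balance_ge0 f0_robust sob.
exists (fun l a => `|output (exec compute_flow s2) l a|%N).
(* The computed values are nonnegative, so they are a flow in the natural numbers. *)
have sob' : state_of_balance P
    (fun l a => `|output (exec compute_flow s2) l a|%N%:Z).
  by move=> l i; have /= := sob l i; case: (afix P i) => [a|];
     case: (afree P i) => [a'|] //=; rewrite !gez0_abs.
split=> [l a| | |] //; first by rewrite gez0_abs.
  exact: state_of_balance_optimal f0_robust sob'.
have k_gt0 := scen_gt0 I.
have c1 := clock_compute_states sn sk.
have c2 := clock_compute_minima s1n s1k.
have c3 := clock_compute_flow s2n s2k.
apply: leq_trans c3 _; move: (clock s2) (clock s1) c1 c2 => x y; nia.
Qed.
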